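(* Let $\Sigma$ be any unary attribute. If $\Sigma o$ holds, and if for every $\xi$ with $N\xi$ one has that $\Sigma\xi$ implies $\Sigma s(\xi)$, then $\Sigma\xi$ holds for every $\xi$ with $N\xi$.
   Context: Setting. All reasoning is classical (with equality). $U$ is a nonempty universe of ''objects'' equipped with a total binary operation $U\times U\to U$, $(f,x)\mapsto f(x)$. Greek and Latin lowercase letters denote elements of $U$; all quantifiers over objects range over $U$. We say that $x$ is in the domain of $f$, written $x\in\mathrm{dom}(f)$, if $f(x)\neq f$ (so $x\notin\mathrm{dom}(f)$ means $f(x)=f$). An attribute of $k$ objects is a $k$-ary relation on $U$ definable by a first-order formula built from equality and the operation $f(x)$, with parameters from $U$ allowed. Definitions. For a unary attribute $\Gamma$: $M(\Gamma)$ means that there is an object $\phi$ such that every $\xi$ with $\Gamma\xi$ lies in $\mathrm{dom}(\phi)$; $D(\Gamma)\phi$ means that for all $\xi$, $\Gamma\xi$ holds if and only if $\xi\in\mathrm{dom}(\phi)$. $C\phi$ (''$\phi$ is an identity object'') means $\phi(\xi)=\xi$ for all $\xi\in\mathrm{dom}(\phi)$. $E\phi\xi$ means: if $\xi\notin\mathrm{dom}(\phi)$ then $\phi=\xi$ (that is, $\xi\in\mathrm{dom}(\phi)$ or $\xi=\phi$). $H\psi\phi$ (''$\psi$ is a successor of $\phi$'') means: $C\psi$, and for all $\xi$, $E\phi\xi$ if and only if $\xi\in\mathrm{dom}(\psi)$. Axioms assumed. (Object uniqueness) If $\phi\neq\psi$, there is $\xi$ with $\phi(\xi)\neq\psi(\xi)$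 and such that $\xi\notin\mathrm{dom}(\phi)$ implies $\xi\in\mathrm{dom}(\psi)$. (Choice) For all unary attributes $\Gamma,\Delta$ and every binary attribute $\Sigma$: if $M(\Gamma)$ and for every $\xi$ with $\Gamma\xi$ there is $\eta$ with $\Delta\eta$ and $\eta\,\Sigma\,\xi$, then there is an object $f$ with $D(\Gamma)f$ such that for every $\xi$ with $\Gamma\xi$ one has $\Delta(f(\xi))$ and $f(\xi)\,\Sigma\,\xi$. (Universe) For every $\phi$ there is $\psi$ such that: $\phi\in\mathrm{dom}(\psi)$; for all $\xi\in\mathrm{dom}(\phi)$, $\phi(\xi)\in\mathrm{dom}(\psi)$; for all $\xi\in\mathrm{dom}(\phi)$ and all $\eta\in\mathrm{dom}(\xi)$, $\eta\in\mathrm{dom}(\psi)$; and for every $\xi\notin\mathrm{dom}(\psi)$ there is $\eta\in\mathrm{dom}(\xi)$ such that $\eta\in\mathrm{dom}(\phi)$ implies $\xi(\eta)\neq\eta$. (Infinity) For every $\phi$ there is $\psi$ with $\phi\in\mathrm{dom}(\psi)$ such that for every $\xi\in\mathrm{dom}(\psi)$ there is $\eta\in\mathrm{dom}(\psi)$ with $H\eta\xi$. Natural numbers. $o$ is a designated object with empty domain, i.e. $o(\eta)=o$ for all $\eta$ (such an object exists by the axioms). $S\phi$ (''$\phi$ has inductive domain'') means: $o\in\mathrm{dom}(\phi)$, and for every $\xi\in\mathrm{dom}(\phi)$ there is $\eta\in\mathrm{dom}(\phi)$ with $H\eta\xi$. $N\xi$ (''$\xi$ is a natural number'') means: $\xi\in\mathrm{dom}(\phi)$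 for every $\phi$ with $S\phi$. $T\sigma$ means: $D(N)\sigma$, and $H\,\sigma(\xi)\,\xi$ for every $\xi$ with $N\xi$. $s$ is a designated object with $Ts$ (such an object exists by the axioms); thus $\mathrm{dom}(s)$ consists exactly of the natural numbers and $s(\xi)$ is a successor of $\xi$ for each natural number $\xi$. *)

(* Defs.v *)
(** First-order formulas over equality and one binary function symbol, with
    de Bruijn indices: [All] and [Ex] bind variable 0 of their body. *)
Inductive term : Type :=
| Var (n : nat)
| App (t u : term).

Inductive formula : Type :=
| Eq (t u : term)
| Bot
| And (A B : formula)
| Or (A B : formula)
| Imp (A B : formula)
| All (A : formula)
| Ex (A : formula).

Definition scons {U : Type} (x : U) (e : nat -> U) (n : nat) : U :=
  match n with
  | 0 => x
  | S m => e m
  end.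

Section Objects.

Context {U : Type} (app : U -> U -> U).

Fixpoint eval (e : nat -> U) (t : term) : U :=
  match t with
  | Var n => e n
  | App t u => app (eval e t) (eval e u)
  end.

Fixpoint sat (e : nat -> U) (A : formula) : Prop :=
  match A with
  | Eq t u => eval e t = eval e u
  | Bot => False
  | And A B => sat e A /\ sat e B
  | Or A B => sat e A \/ sat e B
  | Imp A B => sat e A -> sat e B
  | All A => forall x : U, sat (scons x e) A
  | Ex A => exists x : U, sat (scons x e) A
  end.

(** The valuation [e] supplies the parameters: every free variable of [A] other
    than those standing for the arguments is interpreted by a fixed object. *)
Definition attribute1 (Gamma : U -> Prop) : Prop :=
  exists (A : formula) (e : nat -> U),
    forall x : U, Gamma x <-> sat (scons x e) A.

Definition attribute2 (Sigma : U -> U -> Prop) : Prop :=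
  exists (A : formula) (e : nat -> U),
    forall x y : U, Sigma x y <-> sat (scons x (scons y e)) A.

(** [in_dom f x] is "x is in dom(f)". *)
Definition in_dom (f x : U) : Prop := app f x <> f.

Definition M (Gamma : U -> Prop) : Prop :=
  exists phi : U, forall xi : U, Gamma xi -> in_dom phi xi.

Definition D (Gamma : U -> Prop) (phi : U) : Prop :=
  forall xi : U, Gamma xi <-> in_dom phi xi.

Definition C (phi : U) : Prop :=
  forall xi : U, in_dom phi xi -> app phi xi = xi.

Definition E (phi xi : U) : Prop := ~ in_dom phi xi -> phi = xi.

(** [H psi phi]: psi is a successor of phi. *)
Definition H (psi phi : U) : Prop :=
  C psi /\ forall xi : U, E phi xi <-> in_dom psi xi.

Definition object_uniqueness : Prop :=
  forall phi psi : U, phi <> psi ->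
    exists xi : U,
      app phi xi <> app psi xi /\ (~ in_dom phi xi -> in_dom psi xi).

Definition choice : Prop :=
  forall (Gamma Delta : U -> Prop) (Sigma : U -> U -> Prop),
    attribute1 Gamma -> attribute1 Delta -> attribute2 Sigma ->
    M Gamma ->
    (forall xi : U, Gamma xi -> exists eta : U, Delta eta /\ Sigma eta xi) ->
    exists f : U,
      D Gamma f /\
      forall xi : U, Gamma xi -> Delta (app f xi) /\ Sigma (app f xi) xi.

Definition universe : Prop :=
  forall phi : U, exists psi : U,
    in_dom psi phi /\
    (forall xi : U, in_dom phi xi -> in_dom psi (app phi xi)) /\
    (forall xi eta : U, in_dom phi xi -> in_dom xi eta -> in_dom psi eta) /\
    (forall xi : U, ~ in_dom psi xi ->
       exists eta : U, in_dom xi eta /\ (in_dom phi eta -> app xi eta <> eta)).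

Definition infinity : Prop :=
  forall phi : U, exists psi : U,
    in_dom psi phi /\
    forall xi : U, in_dom psi xi -> exists eta : U, in_dom psi eta /\ H eta xi.

Definition empty_domain (o : U) : Prop := forall eta : U, app o eta = o.

(** [Ind o phi]: phi has inductive domain ([S] is the successor of [nat]). *)
Definition Ind (o phi : U) : Prop :=
  in_dom phi o /\
  forall xi : U, in_dom phi xi -> exists eta : U, in_dom phi eta /\ H eta xi.

Definition N (o xi : U) : Prop := forall phi : U, Ind o phi -> in_dom phi xi.

Definition T (o sigma : U) : Prop :=
  D (N o) sigma /\ forall xi : U, N o xi -> H (app sigma xi) xi.

End Objects.

(* Main.v *)
(** Separation is an instance of Choice: the objects of [dom s] satisfying
    [Sigma] form the domain of some object [f].  By object uniqueness successors
    are unique, so the natural numbers are closed under [s], and the hypotheses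
    on [Sigma] say that [f] has inductive domain. *)
From Stdlib Require Import Classical.
Require Import Defs.

Fixpoint rename_term (r : nat -> nat) (t : term) : term :=
  match t with
  | Var n => Var (r n)
  | App t u => App (rename_term r t) (rename_term r u)
  end.

Definition lift_renaming (r : nat -> nat) (n : nat) : nat :=
  match n with
  | 0 => 0
  | S m => S (r m)
  end.

Fixpoint rename (r : nat -> nat) (A : formula) : formula :=
  match A with
  | Eq t u => Eq (rename_term r t) (rename_term r u)
  | Bot => Bot
  | And A B => And (rename r A) (rename r B)
  | Or A B => Or (rename r A) (rename r B)
  | Imp A B => Imp (rename r A) (rename r B)
  | All A => All (rename (lift_renaming r) A)
  | Ex A => Ex (rename (lift_renaming r) A)
  end.

Section Separation.

Context {U : Type} (app : U -> U -> U).

Lemma eval_rename (t : term) (r : nat -> nat) (e e' : nat -> U) :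
  (forall n, e' (r n) = e n) -> eval app e' (rename_term r t) = eval app e t.
Proof.
  intros He; induction t as [n | t IHt u IHu]; simpl.
  - apply He.
  - now rewrite IHt, IHu.
Qed.

Lemma scons_lift_renaming (r : nat -> nat) (e e' : nat -> U) (x : U) :
  (forall n, e' (r n) = e n) ->
  forall n, scons x e' (lift_renaming r n) = scons x e n.
Proof. intros He [| n]; [reflexivity | apply He]. Qed.

(** The valuations are related pointwise and quantified after [A], so that the induction hypothesis
    applies under a binder, where both are extended by the same object. *)
Lemma sat_rename (A : formula) (r : nat -> nat) (e e' : nat -> U) :
  (forall n, e' (r n) = e n) -> sat app e' (rename r A) <-> sat app e A.
Proof.
  revert r e e'.
  induction A as [t u | | A IHA B IHB | A IHA B IHB | A IHA B IHB | A IHA | A IHA];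
    intros r e e' He; simpl.
  - now rewrite !(eval_rename _ r e e' He).
  - tauto.
  - now rewrite (IHA r e e' He), (IHB r e e' He).
  - now rewrite (IHA r e e' He), (IHB r e e' He).
  - now rewrite (IHA r e e' He), (IHB r e e' He).
  - split; intros HA x;
      apply (IHA _ _ _ (scons_lift_renaming r e e' x He)), HA.
  - split; intros [x HA]; exists x;
      apply (IHA _ _ _ (scons_lift_renaming r e e' x He)), HA.
Qed.

Lemma attribute1_in_dom_and (a : U) (Sigma : U -> Prop) :
  attribute1 app Sigma ->
  attribute1 app (fun x => in_dom app a x /\ Sigma x).
Proof.
  intros (A & e & HA).
  (* The parameter [a] takes index 1, just after the argument; [lift_renaming S] keeps index 0 and
     moves the parameters of [A] up by one to make room. *)
  exists (And (Imp (Eq (App (Var 1) (Var 0)) (Var 1)) Bot)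
              (rename (lift_renaming S) A)), (scons a e).
  intros x; simpl.
  rewrite (sat_rename A (lift_renaming S) (scons x e)), <- HA.
  - reflexivity.
  - now apply scons_lift_renaming.
Qed.

Lemma separation (h_choice : choice app) (a : U) (Sigma : U -> Prop) :
  attribute1 app Sigma ->
  exists f : U, forall x, in_dom app f x <-> in_dom app a x /\ Sigma x.
Proof.
  intros hSigma.
  (* Only the domain of the chosen object matters, so the conditions on its values are trivially
     true; [a] itself bounds the attribute. *)
  destruct (h_choice (fun x => in_dom app a x /\ Sigma x)
              (fun _ => True) (fun _ _ => True)) as (f & Hf & _).
  - now apply attribute1_in_dom_and.
  - exists (Imp Bot Bot), (fun _ => a); simpl; tauto.
  - exists (Imp Bot Bot), (fun _ => a); simpl; tauto.
  - now exists a.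
  - now exists a.
  - exists f; intros x; symmetry; apply Hf.
Qed.

(** Two successors of [x] are identity objects with the same domain. A point separating them would
    lie in one domain, hence in both, and both would fix it. *)
Lemma successor_unique (h_uniqueness : object_uniqueness app) (x y z : U) :
  H app y x -> H app z x -> y = z.
Proof.
  intros [Cy Hy] [Cz Hz].
  apply NNPP; intros Hyz.
  destruct (h_uniqueness y z Hyz) as (w & Hneq & Hdom).
  assert (Hyw : in_dom app y w).
  { apply NNPP; intros Hn; apply Hn, Hy, Hz, Hdom, Hn. }
  apply Hneq; rewrite (Cy w Hyw), Cz; [reflexivity |].
  now apply Hz, Hy.
Qed.

Lemma N_zero (o : U) : N app o o.
Proof. now intros phi [Ho _]. Qed.

(** Each inductive domain containing [x] contains some successor of [x], which is [y] by
    uniqueness. *)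
Lemma N_successor (h_uniqueness : object_uniqueness app) (o x y : U) :
  N app o x -> H app y x -> N app o y.
Proof.
  intros Nx Hyx phi Hphi.
  destruct (proj2 Hphi x (Nx phi Hphi)) as (z & Hz & Hzx).
  now rewrite (successor_unique h_uniqueness x y z Hyx Hzx).
Qed.

End Separation.

Theorem theorem49 (U : Type) (app : U -> U -> U)
  (h_uniqueness : object_uniqueness app)
  (h_choice : choice app)
  (h_universe : universe app)
  (h_infinity : infinity app)
  (o : U) (ho : empty_domain app o)
  (s : U) (hs : T app o s)
  (Sigma : U -> Prop) (hSigma : attribute1 app Sigma) :
  Sigma o ->
  (forall xi : U, N app o xi -> Sigma xi -> Sigma (app s xi)) ->
  forall xi : U, N app o xi -> Sigma xi.
Proof.
  intros Ho Hs xi Nxi.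
  destruct hs as [Ds Hsucc].
  destruct (separation app h_choice s Sigma hSigma) as [f Hf].
  (* A natural number lies in every inductive domain, so in that of [f], where [Sigma] holds. *)
  enough (Hind : Ind app o f) by now apply Hf, Nxi.
  split.
  - apply Hf; split; [apply (proj1 (Ds o)), N_zero | exact Ho].
  - intros x [Hx Sx]%Hf.
    (* Membership in the domain of [s] says that [x] is a natural number, which makes [app s x] a
       successor of [x]. *)
    apply (proj2 (Ds x)) in Hx.
    exists (app s x); split; [| now apply Hsucc].
    apply Hf; split; [| now apply Hs].
    apply (proj1 (Ds (app s x))), (N_successor app h_uniqueness o x); [exact Hx | now apply Hsucc].
Qed.
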